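(* Let $1\le n<\omega$, let $\mathcal I\subseteq\mathcal P(n)$, and let $\mathcal A$ be an $(n,\mathcal I)$-grid. Then $\mathcal A$ is $\mathcal I$-twisted if and only if $\mathcal A$ is twisted.
   Context: For finite $I\subseteq\omega$, an $I$-indexed hyperspace is $\mathcal A=(A;E_i)_{i\in I}$ with each $E_i$ an equivalence relation on $A$ ($n$-indexed means $I=n=\{0,\dots,n-1\}$); $[a]_i$ is the $E_i$-class of $a$. For $J\subseteq I$, $\mathcal A\upharpoonright J=(A;E_j)_{j\in J}$; for $B\subseteq A$, $\mathcal A|B$ is the substructure with universe $B$. An $n$-indexed hyperspace is an $(n,\mathcal I)$-grid if $\bigcap_{i\in J}[a]_i$ is finite for all $J\in\mathcal I$ and $a\in A$. A set $T$ is a transversal of a finite family $\mathcal I$ of sets if $T\cap J\ne\emptyset$ for every $J\in\mathcal I$. If $|A|=\kappa>\aleph_0$, a filtration for $\mathcal A$ is a sequence $\langle A_\alpha:\alpha<\kappa\rangle$ of subsets of $A$ with each $|A_\alpha|<\kappa$ such that $\langle\mathcal A|A_\alpha:\alpha<\kappa\rangle$ is an increasing continuous chain of elementary substructures of $\mathcal A$ with union $\mathcal A$. For $\alpha<\kappa$ and $J\subseteq I$ put $B_{\alpha,J}=\{x\in A_{\alpha+1}\setminus A_\alpha:\forall i\in I\,(i\in J\leftrightarrow[x]_i\cap A_\alpha=\emptyset)\}$. Twisted (recursion on cardinality): an $I$-indexed $\mathcal A$ is twisted if (0) $\bigcap_{i\in I}[a]_i$ is finite for every $a$, and either (1) $A$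 is countable or (2) $|A|=\kappa>\aleph_0$ and some filtration has $\mathcal A|A_0$ twisted and $(\mathcal A|B_{\alpha,J})\upharpoonright J$ twisted for every $\alpha<\kappa$ and nonempty $J\subseteq I$. For $\mathcal I\subseteq\mathcal P(I)$, $\mathcal I$-twisted (recursion on cardinality): $\mathcal A$ is $\mathcal I$-twisted if (0) $\bigcap_{i\in I}[a]_i$ is finite for every $a$, and either (1) $A$ is countable or (2) $|A|=\kappa>\aleph_0$ and some filtration has $\mathcal A|A_0$ $\mathcal I$-twisted and $(\mathcal A|B_{\alpha,J})\upharpoonright J$ $(\mathcal I\cap\mathcal P(J))$-twisted for every $\alpha<\kappa$ and every transversal $J\subseteq I$ of $\mathcal I$. *)

(* Defs.v *)
From mathcomp Require Import all_boot finmap.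
From mathcomp Require Import boolp classical_sets functions cardinality wochoice.
From Stdlib Require Import RelationClasses.

Set Implicit Arguments.
Unset Strict Implicit.
Unset Printing Implicit Defensive.

Local Open Scope classical_set_scope.
Local Open Scope fset_scope.

(** The universe may be empty: the pieces [A | B_(alpha, J)] often are. *)
Record hyperspace (I : {fset nat}) := Hyperspace {
  univ :> Type;
  hrel : I -> univ -> univ -> Prop;
  hrel_equiv : forall i, Equivalence (hrel i) }.

Section HyperspaceOps.
Variables (I : {fset nat}) (A : hyperspace I).

Definition eqclass (i : I) (a : A) : set A := [set x | hrel i a x].

(** For [J] disjoint from [I] this is the whole universe. *)
Definition cap_eqclass (J : {fset nat}) (a : A) : set A :=
  (\bigcap_(i in [set i : I | val i \in J]) eqclass i a)%classic.

Lemma reduct_equiv (J : {fset nat}) (sJI : J `<=` I) (j : J) :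
  Equivalence (@hrel I A (fincl sJI j)).
Proof. exact: hrel_equiv. Qed.

Definition reduct (J : {fset nat}) (sJI : J `<=` I) : hyperspace J :=
  Hyperspace (reduct_equiv sJI).

Lemma substr_equiv (B : set A) (i : I) :
  Equivalence (fun x y : B => hrel i (val x) (val y)).
Proof.
have [r s t] := hrel_equiv A i.
by split=> [x|x y|x y z]; [exact: r|exact: s|exact: t].
Qed.

Definition substr (B : set A) : hyperspace I := Hyperspace (substr_equiv B).

End HyperspaceOps.

(** First-order formulas over the relation symbols [E_i], [i] in [I], and
    equality, with de Bruijn variables: [formula I m] has its free variables
    among [m] of them.  Scoping formulas this way makes sentences
    ([m = 0]) meaningful in the empty structure too. *)
Inductive formula (I : {fset nat}) : nat -> Type :=
| FFalse m : formula I m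
| FEq m : 'I_m -> 'I_m -> formula I m
| FRel m : I -> 'I_m -> 'I_m -> formula I m
| FImp m : formula I m -> formula I m -> formula I m
| FAll m : formula I m.+1 -> formula I m.

Definition env_cons (T : Type) (m : nat) (a : T) (v : 'I_m -> T)
    (k : 'I_m.+1) : T :=
  if unlift ord0 k is Some j then v j else a.

Fixpoint sat (I : {fset nat}) (A : hyperspace I) (m : nat)
    (phi : formula I m) : ('I_m -> A) -> Prop :=
  match phi in formula _ m return ('I_m -> A) -> Prop with
  | FFalse _ => fun _ => False
  | FEq _ x y => fun v => v x = v y
  | FRel _ i x y => fun v => hrel i (v x) (v y)
  | FImp _ p q => fun v => sat p v -> sat q v
  | FAll _ p => fun v => forall a : A, sat p (env_cons a v)
  end.

Definition elementary (I : {fset nat}) (A : hyperspace I) (B : set A) : Prop :=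
  forall (m : nat) (phi : formula I m) (v : 'I_m -> substr B),
    sat phi v <-> sat phi (fun k => val (v k) : A).

Definition card_lt (T U : Type) (X : set T) (Y : set U) : bool :=
  (X #<= Y)%card && ~~ (Y #<= X)%card.

(** Ordinals are represented by types [K] with a (reflexive) well-order [R];
    the cardinal [kappa], as an initial ordinal, is a well-ordered type of
    size [kappa] all of whose proper initial segments are smaller. *)
Section OrdinalIndices.
Variables (K : Type) (R : rel K).

Definition strictly_below (a b : K) : Prop := R a b /\ a <> b.

Definition initial_ordinal : Prop :=
  well_order R /\
  forall a, card_lt [set b | strictly_below b a]%classic [set: K]%classic.

Definition is_zero (z : K) : Prop := forall a, R z a.

Definition is_succ (a b : K) : Prop :=
  strictly_below a b /\ forall c, strictly_below a c -> R b c.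

Definition is_limit (l : K) : Prop :=
  ~ is_zero l /\ forall a, ~ is_succ a l.

End OrdinalIndices.

Section Filtration.
Variables (I : {fset nat}) (A : hyperspace I) (K : Type) (R : rel K).

Record is_filtration (F : K -> set A) : Prop := IsFiltration {
  filtration_index : initial_ordinal R;
  filtration_card : ([set: K] #= [set: A])%card;
  filtration_small : forall a, card_lt (F a) [set: A]%classic;
  filtration_elementary : forall a, elementary (F a);
  filtration_increasing : forall a b, R a b -> (F a `<=` F b)%classic;
  filtration_continuous : forall l, is_limit R l ->
    F l = (\bigcup_(a in [set a | strictly_below R a l]) F a)%classic;
  filtration_union : (\bigcup_a F a = [set: A])%classic }.

(** [B_(alpha, J)], to be used with [b] the successor of [a = alpha]. *)
Definition new_part (F : K -> set A) (a b : K) (J : {fset nat}) : set A :=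
  [set x | (F b `\` F a)%classic x /\
    forall i : I, val i \in J <-> (eqclass i x `&` F a = set0)%classic]%classic.

End Filtration.

(** The recursions on cardinality defining the next two notions are rendered
    as inductive predicates: every structure occurring in a premise has
    smaller cardinality than the one in the conclusion, so the recursion
    equations have exactly one solution. *)
Inductive twisted : forall I : {fset nat}, hyperspace I -> Prop :=
| Twisted_countable (I : {fset nat}) (A : hyperspace I) :
    (forall a : A, finite_set (cap_eqclass I a)) ->
    countable [set: A]%classic ->
    twisted A
| Twisted_uncountable (I : {fset nat}) (A : hyperspace I)
    (K : Type) (R : rel K) (F : K -> set A) :
    (forall a : A, finite_set (cap_eqclass I a)) ->
    ~ countable [set: A]%classic ->
    is_filtration R F ->
    (forall z, is_zero R z -> twisted (substr (F z))) ->
    (forall a b, is_succ R a b ->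
     forall (J : {fset nat}) (sJI : J `<=` I), J != fset0 ->
       twisted (reduct (substr (new_part F a b J)) sJI)) ->
    twisted A.

Definition fam_transversal (II : {fset {fset nat}}) (T : {fset nat}) : Prop :=
  forall J, J \in II -> T `&` J != fset0.

Inductive family_twisted :
    forall (I : {fset nat}), {fset {fset nat}} -> hyperspace I -> Prop :=
| Family_twisted_countable (I : {fset nat}) (II : {fset {fset nat}})
    (A : hyperspace I) :
    (forall a : A, finite_set (cap_eqclass I a)) ->
    countable [set: A]%classic ->
    family_twisted II A
| Family_twisted_uncountable (I : {fset nat}) (II : {fset {fset nat}})
    (A : hyperspace I) (K : Type) (R : rel K) (F : K -> set A) :
    (forall a : A, finite_set (cap_eqclass I a)) ->
    ~ countable [set: A]%classic ->
    is_filtration R F ->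
    (forall z, is_zero R z -> family_twisted II (substr (F z))) ->
    (forall a b, is_succ R a b ->
     forall (J : {fset nat}) (sJI : J `<=` I), fam_transversal II J ->
       family_twisted (II `&` fpowerset J)
         (reduct (substr (new_part F a b J)) sJI)) ->
    family_twisted II A.

(** The finite ordinal [n = {0, ..., n - 1}]. *)
Definition nat_index (n : nat) : {fset nat} := [fset i in iota 0 n].

Definition is_grid (n : nat) (II : {fset {fset nat}})
    (A : hyperspace (nat_index n)) : Prop :=
  forall J, J \in II -> forall a : A, finite_set (cap_eqclass J a).

(* Main.v *)
Require Import Defs.
From mathcomp Require Import all_boot finmap.
From mathcomp Require Import boolp classical_sets functions cardinality wochoice.

(** If [F] is elementary in [A] and every class [[x]_i], [i] in [J], meets [F],
    then the intersection of these classes is definable with parameters from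
    [F]; when it is finite, elementarity forces it to be contained in [F].
    Hence [B_(alpha, J)] is empty as soon as [J] misses some [J0] for which all
    the sets [cap_eqclass J0 x] are finite.  In a grid this applies to every
    [J] that is not a transversal, and clause (0) makes it apply to the empty
    [J], which is a transversal only of the empty family.  So the two
    recursions differ only in conditions on empty pieces. *)

Set Implicit Arguments.
Unset Strict Implicit.
Unset Printing Implicit Defensive.

Local Open Scope fset_scope.

(** Implication and falsity are the only connectives, so finite conjunctions of premises are
    curried; with negated premises and a false conclusion this also yields finite disjunctions. *)
Definition imp_seq (I : {fset nat}) (m : nat) (T : Type)
    (f : T -> formula I m) (s : seq T) (q : formula I m) : formula I m :=
  foldr (fun x => FImp (f x)) q s.

Lemma sat_imp_seq (I : {fset nat}) (A : hyperspace I) (m : nat) (T : eqType)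
    (f : T -> formula I m) (s : seq T) (q : formula I m) (v : 'I_m -> A) :
  sat (imp_seq f s q) v <-> ((forall x, x \in s -> sat (f x) v) -> sat q v).
Proof.
elim: s => [|x s IH] /=; first by split=> [//|]; apply.
split=> [sq fs|sq fx].
  apply: (proj1 IH (sq _)) => [|y ys]; apply: fs.
    by rewrite inE eqxx.
  by rewrite inE ys orbT.
by apply/IH => fs; apply: sq => y; rewrite inE => /orP[/eqP ->//|/fs].
Qed.

Lemma env_cons0 (T : Type) (m : nat) (a : T) (v : 'I_m -> T) :
  env_cons a v ord0 = a.
Proof. by rewrite /env_cons unlift_none. Qed.

Lemma env_cons_lift (T : Type) (m : nat) (a : T) (v : 'I_m -> T) (k : 'I_m) :
  env_cons a v (lift ord0 k) = v k.
Proof. by rewrite /env_cons liftK. Qed.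

Section Elementary.
Variables (I : {fset nat}) (A : hyperspace I).

(** The formula [forall y, (/\_t E_(e t) (a t) y) -> \/_u y = b u]. *)
Lemma elementary_list_bound (F : set A) (T U : finType) (e : T -> I)
    (a : T -> substr F) (b : U -> substr F) :
  elementary F ->
  (forall y : substr F, (forall t, hrel (e t) (a t) y) -> exists u, y = b u) ->
  forall y : A, (forall t, hrel (e t) (val (a t)) y) ->
  exists u, y = val (b u).
Proof.
move=> elF Fbound y ay.
(* One parameter for each [a t] and each [b u]. The indices in [ta] and [ub] are lifted past [ord0],
   the variable bound by [FAll]. *)
pose m := (#|T| + #|U|)%N.
pose ta t : 'I_m.+1 := lift ord0 (lshift #|U| (enum_rank t)).
pose ub u : 'I_m.+1 := lift ord0 (rshift #|T| (enum_rank u)).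
pose v (k : 'I_m) : substr F :=
  match fintype.split k with inl t => a (enum_val t) | inr u => b (enum_val u) end.
have va t : v (lshift #|U| (enum_rank t)) = a t.
  by rewrite /v (unsplitK (inl _)) enum_rankK.
have vb u : v (rshift #|T| (enum_rank u)) = b u.
  by rewrite /v (unsplitK (inr _)) enum_rankK.
pose phi : formula I m :=
  FAll (imp_seq (fun t => FRel (e t) (ta t) ord0) (enum T)
       (imp_seq (fun u => FImp (FEq I ord0 (ub u)) (FFalse I _)) (enum U)
         (FFalse I _))).
(* Truth of [phi] in the substructure is [Fbound]; elementarity carries it to [A], where it is
   instantiated at [y]. *)
have /(elF m phi v) /(_ y) : sat phi v.
  move=> z; apply/sat_imp_seq => za; apply/sat_imp_seq => zb.
  have [t|u zu] := Fbound z.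
    have /= := za t (mem_enum _ _).
    by rewrite env_cons0 env_cons_lift va.
  apply: (zb u (mem_enum _ _)).
  by rewrite /= env_cons0 env_cons_lift vb.
move=> /sat_imp_seq h.
apply: contrapT => nex; apply: (proj1 (sat_imp_seq _ _ _ _) (h _)).
  by move=> t _ /=; rewrite env_cons0 env_cons_lift va; exact: ay.
move=> u _ /=; rewrite env_cons0 env_cons_lift vb => yu.
by apply: nex; exists u.
Qed.

Lemma elementary_mem (F : set A) (J : {fset nat}) (x : A) :
  elementary F -> finite_set (cap_eqclass J x) ->
  (forall i : I, val i \in J -> (eqclass i x `&` F !=set0)%classic) -> F x.
Proof.
move=> elF fin meet.
have [s sE] : exists s : seq {classic A}, cap_eqclass J x = [set` s]%classic.
  exact/(@finite_seqP {classic A}).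
pose T := {i : I | val i \in J}.
have /choice[a xa] (t : T) : exists y : substr F, hrel (val t) x (val y).
  have [y [xy Fy]] := meet _ (valP t).
  by exists (SigSub (mem_set Fy)).
(* Only the members of the finite intersection that lie in [F] can serve as parameters. They exhaust
   it inside [F], hence also in [A], so [x] is one of them. *)
pose s' : seq {classic A} := [seq y <- s | y \in F].
have s'F (y : {classic A}) : y \in s' -> y \in F by rewrite mem_filter => /andP[].
pose b (u : seq_sub s') : substr F := SigSub (s'F _ (valP u)).
have [|t|u ->] := @elementary_list_bound F T (seq_sub s') val a b elF _ x.
- move=> y ya.
  have ys' : (val y : {classic A}) \in s'.
    rewrite mem_filter (valP y) /=.
    suff : cap_eqclass J x (val y) by rewrite sE.
    move=> i iJ; have [_ _ t] := hrel_equiv A i.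
    apply: t (xa (exist _ i iJ)) _; exact: ya (exist _ i iJ).
  by exists (SeqSub ys'); apply: val_inj.
- by have [_ sym _] := hrel_equiv A (val t); exact: sym.
- exact/set_mem/(valP (b u)).
Qed.

(** For [x] in the piece, an index outside [J] is one whose class meets [F a]. This covers all of
    [J0], so [x] would already lie in [F a]. *)
Lemma new_part_eq0 (K : Type) (F : K -> set A) (a b : K) (J J0 : {fset nat}) :
  elementary (F a) -> (forall x : A, finite_set (cap_eqclass J0 x)) ->
  J `&` J0 = fset0 -> new_part F a b J = set0.
Proof.
move=> elF fin JJ0; apply/seteqP; split=> // x [[_ nFx] xJ].
apply: nFx; apply: (elementary_mem elF (fin x)) => i iJ0.
apply/set0P/eqP => /xJ iJ.
by have := in_fset0 (val i); rewrite -JJ0 inE iJ iJ0.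
Qed.

End Elementary.

(** Extends [is_grid] to arbitrary index sets, as the induction passes to reducts. *)
Definition grid_for (I : {fset nat}) (II : {fset {fset nat}})
    (A : hyperspace I) : Prop :=
  forall J, J \in II -> forall a : A, finite_set (cap_eqclass J a).

Section GridInheritance.
Variables (I : {fset nat}) (II : {fset {fset nat}}) (A : hyperspace I).

Lemma grid_for_substr (B : set A) : grid_for II A -> grid_for II (substr B).
Proof.
move=> gA J JII a.
apply: sub_finite_set (finite_preimage (f := val) _ (gA J JII (val a))).
- by move=> y ay i iJ; exact: ay.
- by move=> ? ? _ _; exact: val_inj.
Qed.

(** For [J0] inside [J], the reduct drops none of the classes being intersected. *)
Lemma grid_for_reduct (J : {fset nat}) (sJI : J `<=` I) :
  grid_for II A -> grid_for (II `&` fpowerset J) (reduct A sJI).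
Proof.
move=> gA J0; rewrite inE fpowersetE => /andP[J0II sJ0J] a.
apply: sub_finite_set (gA J0 J0II a) => y ay i iJ0.
have iJ : val i \in J by exact: (fsubsetP sJ0J).
have := ay [` iJ] iJ0.
by rewrite /eqclass /=; congr (hrel _ _ _); apply: val_inj.
Qed.

End GridInheritance.

Lemma reduct_substr_set0 (I : {fset nat}) (A : hyperspace I) (B : set A)
    (J : {fset nat}) (sJI : J `<=` I) :
  B = set0 -> reduct (substr B) sJI -> False.
Proof. by move=> B0 [x]; rewrite B0 inE. Qed.

Lemma empty_countable (T : Type) : (T -> False) -> countable [set: T]%classic.
Proof.
move=> T0; suff -> : [set: T]%classic = set0 by [].
by apply/seteqP; split=> // x /T0.
Qed.

Lemma twisted_empty (I : {fset nat}) (A : hyperspace I) :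
  (A -> False) -> twisted A.
Proof.
move=> A0; apply: Twisted_countable; first by move=> a; case: (A0 a).
exact: empty_countable.
Qed.

Lemma family_twisted_empty (I : {fset nat}) (II : {fset {fset nat}})
    (A : hyperspace I) : (A -> False) -> family_twisted II A.
Proof.
move=> A0; apply: Family_twisted_countable; first by move=> a; case: (A0 a).
exact: empty_countable.
Qed.

Lemma family_twisted_twisted (I : {fset nat}) (II : {fset {fset nat}})
    (A : hyperspace I) : family_twisted II A -> grid_for II A -> twisted A.
Proof.
elim=> {I II A} [I II A fin cA _|I II A K R F fin ncA filF _ IH0 _ IHs gA].
  exact: Twisted_countable.
apply: (Twisted_uncountable fin ncA filF) => [z z0|a b ab J sJI _].
  by apply: IH0 => //; exact: grid_for_substr.
have [trJ|] := pselect (fam_transversal II J).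
  by apply: IHs => //; apply: grid_for_reduct; exact: grid_for_substr.
move=> /existsNP[J0 /not_implyP[J0II /negP /negPn /eqP JJ0]].
have elF : elementary (F a) := filtration_elementary filF (a := a).
apply/twisted_empty/(@reduct_substr_set0 _ _ (new_part F a b J)).
exact: new_part_eq0 elF (gA _ J0II) JJ0.
Qed.

Lemma twisted_family_twisted (I : {fset nat}) (II : {fset {fset nat}})
    (A : hyperspace I) : twisted A -> grid_for II A -> family_twisted II A.
Proof.
(* The family stays general, because it shrinks to its members inside [J] at each piece. *)
move=> tA; elim: tA II => {I A} [I A fin cA II _|].
  exact: Family_twisted_countable.
move=> I A K R F fin ncA filF _ IH0 _ IHs II gA.
apply: (Family_twisted_uncountable fin ncA filF) => [z z0|a b ab J sJI _].
  by apply: IH0 => //; exact: grid_for_substr.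
have [J0|J0] := eqVneq J fset0; last first.
  by apply: IHs => //; apply: grid_for_reduct; exact: grid_for_substr.
have elF : elementary (F a) := filtration_elementary filF (a := a).
apply/family_twisted_empty/(@reduct_substr_set0 _ _ (new_part F a b J)).
(* Clause (0), [fin], is the finiteness hypothesis for the full index set [I], which the empty [J]
   misses. *)
apply: new_part_eq0 elF fin _.
by rewrite J0 fset0I.
Qed.

Theorem theorem2p4 (n : nat) (hn : (1 <= n)%N)
    (II : {fset {fset nat}}) (hII : II `<=` fpowerset (nat_index n))
    (A : hyperspace (nat_index n)) (hA : is_grid II A) :
  family_twisted II A <-> twisted A.
Proof.
split=> tA; first exact: family_twisted_twisted tA hA.
exact: twisted_family_twisted tA hA.
Qed.
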